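(* Define polynomials $A_n \in \mathbb{Z}[x_1, x_2, \dotsc]$ for $n \geq 1$ by the recurrence $$A_1 = x_1, \qquad A_n = \mathcal{D} A_{n-1} \quad (n \geq 2),$$ where $$\mathcal{D} = \sum_{i=1}^\infty x_{i+1} \frac{\partial}{\partial x_i} + \sum_{i,j \geq 1} x_1 x_i x_j \frac{\partial}{\partial x_{i+j}} .$$ Then for every $n \geq 1$, $$A_n = \sum_{p \vdash n} Z_{\mathfrak{A}}(p) \prod_{i=1}^n x_i^{p(i)},$$ where the sum is over all partitions $p$ of $n$, $p(i)$ is the multiplicity of $i$ as a part of $p$, and $Z_{\mathfrak{A}}(p)$ is the number of rising (equivalently, the number of falling) atomic permutations of $[n+1]$ whose run structure is $p$.
   Context: Write $[m] = \{1, \dotsc, m\}$; a permutation of $[m]$ is a word $\sigma = \sigma_1 \cdots \sigma_m$ using each element of $[m]$ exactly once. For $m \geq 2$ a rising atomic permutation of $[m]$ is a permutation with $\sigma_1 = 1$ and $\sigma_m = m$; a falling atomic permutation of $[m]$ is one with $\sigma_1 = m$ and $\sigma_m = 1$. A run of a permutation $\sigma$ of $[m]$ is an integer interval $\{i, i+1, \dotsc, j\} \subseteq [m]$ with $i<j$ such that $\sigma(i), \sigma(i+1), \dotsc, \sigma(j)$ is a monotone sequence (increasing or decreasing) and such that the interval cannot be extended in either direction with this property; its length is $j - i$. The lengths of all runs of $\sigma$ form a partition of $m-1$, called the run structure of $\sigma$. The operator $\mathcal{D}$ is a formal infinite sum acting on polynomials in the variables $x_1, x_2, \dotsc$; on each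 polynomial only finitely many terms are nonzero. *)

(* Defs.v *)
From HB Require Import structures.
From mathcomp Require Import all_boot all_order all_fingroup all_algebra.
From mathcomp Require Import finmap.
From mathcomp Require Import classical_sets cardinality fsbigop.
From mathcomp Require Import monalg.

Set Implicit Arguments.
Unset Strict Implicit.
Unset Printing Implicit Defensive.

Import GRing.Theory.
Local Open Scope ring_scope.

(* Z[x_1, x_2, ...]: the library's indeterminates are indexed by nat, from 0;
   x_i (i >= 1) is the indeterminate of index i.-1.  All indices passed to
   [xvar] and [pderiv] below are positive. *)
Notation Zx := {malg int[{cmonom nat}]}.

Definition xvar (i : nat) : Zx := << ucm i.-1 >>.

(* d/dx_i, monomial by monomial: c * m |-> (c * m_i) * (m / x_i).  The division
   is truncated, which only matters for monomials with m_i = 0, whose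
   coefficient is then multiplied by 0. *)
Definition pderiv (i : nat) (f : Zx) : Zx :=
  \sum_(m <- msupp f) << f@_m *+ m i.-1 *g divcm m (ucm i.-1) >>.

(* Sums over infinite index sets in which finitely many terms are nonzero, by
   [D_finite1] and [D_finite2] below (the library's sum is 0 otherwise). *)
Definition D (f : Zx) : Zx :=
  \sum_(i \in [set i : nat | (0 < i)%N]%classic) xvar i.+1 * pderiv i f
  + \sum_(ij \in [set ij : nat * nat | (0 < ij.1)%N && (0 < ij.2)%N]%classic)
      xvar 1 * xvar ij.1 * xvar ij.2 * pderiv (ij.1 + ij.2)%N f.

Lemma pderiv_eq0 (f : Zx) : exists N, forall i, (N < i)%N -> pderiv i f = 0.
Proof.
pose B := (\max_(m <- msupp f) \max_(k <- finsupp (cmonom_val m)) k)%N.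
exists B.+1 => i ltBi; rewrite /pderiv big_seq big1 // => m mf.
suff -> : m i.-1 = 0%N by rewrite mulr0n monalgU0.
apply/eqP; apply: contraTT ltBi; rewrite cmE_neq0 => im.
have le1 : (i.-1 <= \max_(k <- finsupp (cmonom_val m)) k)%N.
  exact: (leq_bigmax_seq (F := fun k : nat => k)).
have le2 : (\max_(k <- finsupp (cmonom_val m)) k <= B)%N.
  exact: (leq_bigmax_seq
    (F := fun m : {cmonom nat} => (\max_(k <- finsupp (cmonom_val m)) k)%N)).
rewrite -leqNgt; apply: leq_trans (leqSpred i) _.
by rewrite ltnS; apply: leq_trans le1 le2.
Qed.

Lemma D_finite1 (f : Zx) :
  finite_set [set i : nat | xvar i.+1 * pderiv i f != 0]%classic.
Proof.
have [N fN] := pderiv_eq0 f.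
apply: (@sub_finite_set _ _ `I_N.+1) (finite_II _) => i /=.
by apply: contraR; rewrite -leqNgt => /fN ->; rewrite mulr0.
Qed.

Lemma D_finite2 (f : Zx) :
  finite_set [set ij : nat * nat |
    xvar 1 * xvar ij.1 * xvar ij.2 * pderiv (ij.1 + ij.2)%N f != 0]%classic.
Proof.
have [N fN] := pderiv_eq0 f.
apply: (@sub_finite_set _ _ (`I_N.+1 `*` `I_N.+1)%classic).
  move=> [i j] /= nz; suff leN : (i + j <= N)%N.
    by split; rewrite /= ltnS; apply: leq_trans leN; rewrite ?leq_addr ?leq_addl.
  by apply: contraR nz; rewrite -ltnNge => /fN ->; rewrite mulr0.
by apply: finite_setX; apply: finite_II.
Qed.

(* A_1 = x_1 and A_n = D A_(n-1) for n >= 2. *)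
Definition A (n : nat) : Zx := iter n.-1 D (xvar 1).

Local Open Scope nat_scope.

Definition is_intpart (n : nat) (p : seq nat) : bool :=
  [&& sorted geq p, all (leq 1) p & sumn p == n].

Record intpart (n : nat) := IntPart {
  parts :> seq nat;
  partsP : is_intpart n parts
}.

HB.instance Definition _ n := [isSub for @parts n].
HB.instance Definition _ n := [Countable of intpart n by <:].

Definition intpart_code n (p : intpart n) : {bseq n of 'I_n.+1} :=
  insub_bseq n (map inord p).

Definition intpart_decode n (b : {bseq n of 'I_n.+1}) : option (intpart n) :=
  insub (map val b).

Lemma intpart_codeK n : pcancel (@intpart_code n) (@intpart_decode n).
Proof.
case=> p pP; rewrite /intpart_decode /intpart_code /=.
have /and3P[_ p_gt0 /eqP sp] := pP.
have szp : size p <= n.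
  rewrite -sp; elim: p p_gt0 {pP sp} => //= a p IHp /andP[a0 /IHp].
  by rewrite -add1n; apply: leq_add.
have lep a : a \in p -> a < n.+1.
  rewrite ltnS -sp; elim: p {pP sp p_gt0 szp} => //= b p IHp.
  rewrite inE => /orP[/eqP->|/IHp le]; first exact: leq_addr.
  by apply: leq_trans le (leq_addl _ _).
have -> : map val (insub_bseq n (map (@inord n) p)) = p.
  rewrite /insub_bseq val_insubd size_map szp -map_comp -[RHS]map_id.
  by apply/eq_in_map => a /lep /= lea; rewrite inordK.
by rewrite insubT.
Qed.

HB.instance Definition _ n : isFinite (intpart n) := PCanIsFinite (@intpart_codeK n).

(* [m] is represented by 'I_m = {0, ..., m-1}, for positions and for values. *)
Definition monotone_on m (s : 'S_m) (i j : 'I_m) : bool :=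
  [forall a : 'I_m, forall b : 'I_m, [&& i <= a, a < b & b <= j] ==> (s a < s b)]
  || [forall a : 'I_m, forall b : 'I_m, [&& i <= a, a < b & b <= j] ==> (s b < s a)].

(* (i, j) stands for the interval {i, ..., j}. *)
Definition is_run m (s : 'S_m) (r : 'I_m * 'I_m) : bool :=
  [&& r.1 < r.2, monotone_on s r.1 r.2
    & [forall r' : 'I_m * 'I_m,
         [&& r'.1 <= r.1, r.2 <= r'.2 & monotone_on s r'.1 r'.2] ==> (r' == r)]].

Definition run_structure m (s : 'S_m) : seq nat :=
  sort geq [seq r.2 - r.1 | r : 'I_m * 'I_m in is_run s].

(* Atomic permutations of [n+1]; this is the condition for n+1 >= 2. *)
Definition rising_atomic n (s : 'S_n.+1) : bool :=
  (s ord0 == ord0) && (s ord_max == ord_max).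

Definition falling_atomic n (s : 'S_n.+1) : bool :=
  (s ord0 == ord_max) && (s ord_max == ord0).

Definition Z_rising n (p : intpart n) : nat :=
  #|[set s : 'S_n.+1 | rising_atomic s & run_structure s == p]|.

Definition Z_falling n (p : intpart n) : nat :=
  #|[set s : 'S_n.+1 | falling_atomic s & run_structure s == p]|.

(* Main.v *)
(** Removing the second largest value n from a rising atomic permutation of
    [n+1] leaves a rising atomic permutation of [n]; conversely n can be
    inserted between any two neighbours of a rising atomic permutation of [n]
    (with maximum renamed to n+1).  Inserted in the last gap, n extends the last
    run; in any other gap it becomes a peak.  A run of length l has l gaps:
    those, l-1 in number, which are neither last nor next to a peak split the
    run into runs of lengths i, 1, j with i + j = l, which is the term
    x_1 x_i x_j d/dx_l of the operator D.  A gap next to a peak lengthens the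
    run on the other side of that peak, so that, with the last gap, each run is
    lengthened exactly once, which is the term x_(l+1) d/dx_l.  Hence D turns
    the generating polynomial of the rising atomic permutations of [n] into that
    of [n+1].  Complementing the values exchanges rising and falling. *)
Require Import Defs.
From mathcomp Require Import all_boot all_order all_fingroup all_algebra.
From mathcomp Require Import finmap.
From mathcomp Require Import classical_sets fsbigop.
From mathcomp Require Import monalg.
From mathcomp Require Import zify ring.

Set Implicit Arguments.
Unset Strict Implicit.
Unset Printing Implicit Defensive.

Import GRing.Theory.
Local Open Scope ring_scope.

(** * The operator as a finite sum, over any commutative ring *)

Section TruncatedOperator.
Variables (R : comNzRingType) (x : nat -> R).

(* [d i] stands for the partial derivative with respect to [x i]. *)
Definition Dtrunc N (d : nat -> R) : R :=
  \sum_(1 <= i < N) x i.+1 * d i +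
  \sum_(1 <= i < N) \sum_(1 <= j < N) x 1 * x i * x j * d (i + j)%N.

(** The image of the variable [x l] under the operator: in the double sum only the pairs with
    [i + j = l] contribute. *)
Definition Dvar l : R := x l.+1 + \sum_(1 <= i < l) x 1 * x i * x (l - i).

Lemma Dtrunc0 (d : nat -> R) : Dtrunc 0 d = 0.
Proof. by rewrite /Dtrunc !big_geq // addr0. Qed.

Lemma eq_Dtrunc N (d e : nat -> R) :
  (forall i, (0 < i)%N -> d i = e i) -> Dtrunc N d = Dtrunc N e.
Proof.
move=> de; rewrite /Dtrunc; congr (_ + _); rewrite !big_nat.
  by apply: eq_bigr => i /andP[i0 _]; rewrite de.
apply: eq_bigr => i /andP[i0 _]; rewrite !big_nat.
by apply: eq_bigr => j /andP[j0 _]; rewrite de // addn_gt0 i0.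
Qed.

Lemma DtruncD N (d e : nat -> R) :
  Dtrunc N (fun i => d i + e i) = Dtrunc N d + Dtrunc N e.
Proof.
rewrite /Dtrunc [RHS]addrACA; congr (_ + _); rewrite -big_split /=.
  by apply: eq_bigr => i _; rewrite mulrDr.
apply: eq_bigr => i _; rewrite -big_split /=.
by apply: eq_bigr => j _; rewrite mulrDr.
Qed.

Lemma DtruncZ N (c : R) (d : nat -> R) :
  Dtrunc N (fun i => c * d i) = c * Dtrunc N d.
Proof.
rewrite /Dtrunc mulrDr !mulr_sumr; congr (_ + _); apply: eq_bigr => i _.
  by rewrite mulrCA.
by rewrite mulr_sumr; apply: eq_bigr => j _; rewrite mulrCA.
Qed.

(** The family is [m] times the partial derivatives of [x l]. The bound [l < N] keeps [l], and every
    pair of positive indices with sum [l], inside the ranges. *)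
Lemma Dtrunc_delta N l (m : R) : (0 < l < N)%N ->
  Dtrunc N (fun i => (i == l)%:R * m) = Dvar l * m.
Proof.
move=> /andP[l0 lN]; rewrite /Dtrunc /Dvar mulrDl; congr (_ + _).
  rewrite (bigD1_seq l) ?mem_index_iota ?l0 ?iota_uniq //= eqxx mul1r.
  by rewrite big1 ?addr0 // => i /negPf ->; rewrite mul0r mulr0.
rewrite (big_cat_nat (n := l)) ?(ltnW lN) //= [X in _ + X]big1_seq ?addr0.
  rewrite mulr_suml !big_nat; apply: eq_bigr => i /andP[i0 il].
  rewrite (bigD1_seq (l - i)%N) ?iota_uniq //=; last first.
    by rewrite mem_index_iota subn_gt0 il (leq_ltn_trans (leq_subr _ _)).
  rewrite subnKC ?(ltnW il) // eqxx mul1r big1 ?addr0 // => j jl.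
  rewrite -(eqn_add2l i) subnKC ?(ltnW il) // in jl.
  by rewrite (negPf jl) mul0r mulr0.
move=> i /andP[_]; rewrite mem_index_iota => /andP[li _].
rewrite big1_seq // => j /andP[_]; rewrite mem_index_iota => /andP[j0 _].
by rewrite gtn_eqF ?mul0r ?mulr0 // -(addn0 l) -addnS leq_add.
Qed.

End TruncatedOperator.

(** * Additivity and Leibniz rule for [pderiv] and [D] *)

Lemma pderivEw (d : {fset {cmonom nat}}) i (f : Zx) : (msupp f `<=` d)%fset ->
  pderiv i f = \sum_(m <- d) << f@_m *+ m i.-1 *g divcm m (ucm i.-1) >>.
Proof.
move=> le_fd; rewrite /pderiv (big_fset_incl _ le_fd) // => m _.
by move=> /mcoeff_outdom ->; rewrite mul0rn monalgU0.
Qed.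

Lemma pderivD i (f g : Zx) : pderiv i (f + g) = pderiv i f + pderiv i g.
Proof.
(* A common index set for the three sums; monomials outside a support contribute 0. *)
pose d := (msupp f `|` msupp g)%fset.
rewrite (@pderivEw d _ (f + g)) ?msuppD_le // (@pderivEw d _ f) ?fsubsetUl //.
rewrite (@pderivEw d _ g) ?fsubsetUr // -big_split /=; apply: eq_bigr => m _.
by rewrite mcoeffD mulrnDl monalgUD.
Qed.

Lemma pderivU i (m : {cmonom nat}) :
  pderiv i << m >> = << (m i.-1)%:R *g divcm m (ucm i.-1) >>.
Proof. by rewrite /pderiv msuppU1 big_seq_fset1 mcoeffUU. Qed.

Lemma xvarMU l (c : int) (m : {cmonom nat}) :
  xvar l * << c *g m >> = << c *g mmul (ucm l.-1) m >>.
Proof. by rewrite [LHS]fgmulUU mul1r. Qed.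

(** The Leibniz rule on monomials: multiplying by [xvar l] raises the exponent of [xvar i] by
    [i == l], and the coefficient splits accordingly. *)
Lemma pderivMx i l (m : {cmonom nat}) : (0 < i)%N -> (0 < l)%N ->
  pderiv i (xvar l * << m >>) =
    (i == l)%:R * << m >> + xvar l * pderiv i << m >>.
Proof.
case: i l => // i [//|l] _ _.
have E1 : << (i == l)%:R *g divcm (mmul (ucm l) m) (ucm i) >> =
    (i == l)%:R * << m >> :> Zx.
  have [->|_] := eqVneq i l; last by rewrite monalgU0 mul0r.
  rewrite mul1r; apply: (congr1 (fun k => << k >>)); apply/eqP/cmP=> k.
  by rewrite divcmE cmM addKn.
have E2 : << (m i)%:R *g divcm (mmul (ucm l) m) (ucm i) >> =
    << (m i)%:R *g mmul (ucm l) (divcm m (ucm i)) >> :> Zx.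
  (* Truncated division need not commute with the multiplication when [m i = 0], but then both
     coefficients vanish. *)
  have [->|mi0] := eqVneq (m i) 0%N; first by rewrite !monalgU0.
  apply: (congr1 (fun k => << _ *g k >>)); apply/eqP/cmP=> k.
  rewrite divcmE !cmM divcmE !cmU.
  have [<-|_] := eqVneq i k; last by rewrite !subn0.
  by rewrite addnBA // lt0n.
rewrite xvarMU [LHS]pderivU [in RHS]pderivU xvarMU /= cmM cmU natrD monalgUD.
by rewrite eqSS -E1 -E2 eq_sym.
Qed.

(** In the double sum, a pair with one index at least [N] also has sum at least [N], so its term
    vanishes. *)
Lemma D_trunc N (f : Zx) : (forall i, (N <= i)%N -> pderiv i f = 0) ->
  D f = Dtrunc xvar N (fun i => pderiv i f).
Proof.
move=> fN; rewrite /D /Dtrunc; congr (_ + _).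
  rewrite (fsbigE (index_iota 1 N)) ?iota_uniq //.
  - rewrite big_seq_cond [RHS]big_seq; apply: eq_bigl => i.
    by apply: andb_idr; rewrite mem_index_iota inE => /andP[].
  - by move=> i /=; rewrite mem_index_iota => /andP[].
  move=> i /= i0; rewrite mem_index_iota i0 /= -leqNgt => /fN ->.
  by rewrite mulr0.
rewrite (fsbigE [seq (i, j) | i <- index_iota 1 N, j <- index_iota 1 N]).
- rewrite big_seq_cond (eq_bigl (fun ij => ij \in
    [seq (i, j) | i <- index_iota 1 N, j <- index_iota 1 N])); last first.
    move=> ij; apply: andb_idr => /allpairsP[[i j] /= [+ + ->]].
    by rewrite !mem_index_iota inE /= => /andP[-> _] /andP[->].
  by rewrite -big_seq big_allpairs.
- by apply: allpairs_uniq; rewrite ?iota_uniq // => -[? ?] [? ?].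
- move=> ij /allpairsP[[i j] /= [+ + ->]] /=.
  by rewrite !mem_index_iota => /andP[-> _] /andP[->].
move=> [i j] /= /andP[i0 j0] ij; rewrite fN ?mulr0 // leqNgt.
apply: contra ij => ijN; apply/allpairsP; exists (i, j).
rewrite !mem_index_iota i0 j0 /=; split=> //; apply: leq_ltn_trans ijN.
  exact: leq_addr.
exact: leq_addl.
Qed.

(** Allowing every larger [M] lets several polynomials be truncated at a common place. *)
Lemma pderiv_bound (f : Zx) :
  exists N, forall M i, (N <= M)%N -> (M <= i)%N -> pderiv i f = 0.
Proof.
have [N fN] := pderiv_eq0 f; exists N.+1 => M i leM lei; apply: fN.
exact: leq_trans leM lei.
Qed.

Lemma DD (f g : Zx) : D (f + g) = D f + D g.
Proof.
have [[N fN] [M gM]] := (pderiv_bound f, pderiv_bound g).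
have leN := leq_maxl N M; have leM := leq_maxr N M.
rewrite (D_trunc (fN _ ^~ leN)) (D_trunc (gM _ ^~ leM)) -DtruncD.
rewrite (@D_trunc (maxn N M)) => [|i lei].
  by apply: eq_Dtrunc => i _; apply: pderivD.
by rewrite pderivD (fN _ _ leN lei) (gM _ _ leM lei) addr0.
Qed.

Lemma D0 : D 0 = 0.
Proof. by apply: (addrI (D 0)); rewrite -DD !addr0. Qed.

Lemma D_sum (I : Type) (r : seq I) (P : pred I) (F : I -> Zx) :
  D (\sum_(i <- r | P i) F i) = \sum_(i <- r | P i) D (F i).
Proof. exact: (big_morph D DD D0). Qed.

Lemma D_xvarM l (m : {cmonom nat}) : (0 < l)%N ->
  D (xvar l * << m >>) = Dvar xvar l * << m >> + xvar l * D << m >>.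
Proof.
move=> l0; have [N mN] := pderiv_bound << m >>.
(* [l.+1] enters the maximum so that the index [l] lies inside the truncation. *)
have leM := leq_maxl N l.+1; have ltM := leq_maxr N l.+1.
rewrite (D_trunc (mN _ ^~ leM)) -DtruncZ.
rewrite -(@Dtrunc_delta _ _ (maxn N l.+1)) ?l0 //.
rewrite -DtruncD (@D_trunc (maxn N l.+1)) => [|i lei].
  by apply: eq_Dtrunc => i i0; apply: pderivMx.
rewrite pderivMx // ?(leq_trans _ lei) ?(leq_trans _ ltM) // (mN _ _ leM lei).
by rewrite gtn_eqF ?(leq_trans ltM lei) // mul0r mulr0 addr0.
Qed.

(** * Boolean words, their maximal constant blocks, and the operator on block weights *)

Fixpoint blocks (w : seq bool) : seq nat :=
  if w is b :: w' then
    if ohead w' == Some b then incr_nth (blocks w') 0 else 1%N :: blocks w'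
  else [::].

Lemma blocks_cat a b w : ohead w != Some b ->
  blocks (nseq a.+1 b ++ w) = a.+1 :: blocks w.
Proof.
move=> wb; elim: a => [|a IHa] /=; first by rewrite (negPf wb).
by rewrite /= in IHa; rewrite eqxx IHa.
Qed.

Lemma first_block (b : bool) w :
  exists a w', w = nseq a b ++ w' /\ ohead w' != Some b.
Proof.
elim: w => [|c w [a [w' [-> w'b]]]]; first by exists 0%N, [::].
have [->|cb] := eqVneq c b; first by exists a.+1, w'.
by exists 0%N, (c :: nseq a b ++ w').
Qed.

Lemma cat_nseq_cons (T : Type) k (b : T) v :
  nseq k b ++ b :: v = nseq k.+1 b ++ v.
Proof. by elim: k => //= k ->. Qed.

(* [true] marks an ascent.  On the ascent word of a rising atomic permutation,
   this is the effect of inserting the second largest value in the [t]-th gap: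
   an ascent followed by a descent, unless the gap is the last one. *)
Definition peak_insert t (w : seq bool) : seq bool :=
  take t w ++ true :: (t.+1 == size w) :: drop t.+1 w.

(** A prefix does not affect the test for the last gap: position and size grow by the same
    amount. *)
Lemma peak_insert_cat t u v :
  peak_insert (size u + t) (u ++ v) = u ++ peak_insert t v.
Proof.
rewrite /peak_insert take_cat ltnNge leq_addr /= addKn -catA; congr (_ ++ _).
by rewrite size_cat -addnS eqn_add2l drop_cat ltnNge leq_addr /= addKn.
Qed.

Lemma peak_insert_nseq t a b v : (t <= a)%N ->
  peak_insert t (nseq a.+1 b ++ v) =
    nseq t b ++ true :: (t.+1 == a.+1 + size v)%N :: nseq (a - t) b ++ v.
Proof.
move=> ta; have -> : nseq a.+1 b ++ v = nseq t b ++ (b :: nseq (a - t) b ++ v).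
  by rewrite cat_nseq_cons catA -nseqD addSn subnKC.
rewrite -{1}[t](size_nseq t b) -[size _]addn0 peak_insert_cat /peak_insert /=.
rewrite drop0 size_cat size_nseq.
have <- : (0 == a - t + size v)%N = (t.+1 == a.+1 + size v)%N.
  by rewrite addSn eqSS -{2}(subnKC ta) -addnA -{2}[t]addn0 eqn_add2l.
by [].
Qed.

(** Ensures that a descent block in front of [w] stays separate from it after the insertion. *)
Lemma ohead_peak_insert t w :
  ohead w = Some true -> ohead (peak_insert t w) = Some true.
Proof. by case: w t => // b w [|t]. Qed.

Section WordWeight.
Variables (R : comNzRingType) (x : nat -> R).

Definition word_weight w : R := \prod_(l <- blocks w) x l.

Lemma word_weight_cat a b w : ohead w != Some b ->
  word_weight (nseq a.+1 b ++ w) = x a.+1 * word_weight w.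
Proof. by move=> wb; rewrite /word_weight blocks_cat // big_cons. Qed.

Lemma Dvar_ord l :
  Dvar x l.+1 = x l.+2 + \sum_(i < l) x 1 * x i.+1 * x (l - i)%N.
Proof. by rewrite /Dvar big_add1 big_mkord. Qed.

Variable D : R -> R.
Hypothesis D1 : D 1 = 0.
Hypothesis D_cons : forall l ls, (0 < l)%N ->
  D (x l * \prod_(k <- ls) x k) =
    Dvar x l * \prod_(k <- ls) x k + x l * D (\prod_(k <- ls) x k).

(** Induction on the size, two blocks at a time: a word that begins and ends with an ascent is one
    ascent block, or an ascent block, a descent block and a shorter word of the same kind. Of [D]
    only the derivation rules on monomials enter. *)
Lemma D_word_weight w : ohead w = Some true -> last false w = true ->
  D (word_weight w) = \sum_(t < size w) word_weight (peak_insert t w).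
Proof.
have [n] := ubnP (size w); elim: n => // n IHn in w *.
have [[|a] [u [-> uT]]] := first_block true w.
  by rewrite /= => _ /eqP; rewrite (negPf uT).
have D_w l w' : (0 < l)%N ->
    D (x l * word_weight w') =
      Dvar x l * word_weight w' + x l * D (word_weight w').
  exact: D_cons.
have [[|b] [v [def_u vF]]] := first_block false u.
  (* [u] can begin with neither letter, so the word is a single ascent block: its last gap lengthens
     it, every other gap splits it. *)
  have -> : u = [::] by rewrite def_u in uT *; case: v uT vF {def_u} => [|[]].
  move=> _ _ _; rewrite size_cat size_nseq addn0 word_weight_cat //.
  rewrite D_w // [word_weight [::]]big_nil D1 mulr0 addr0 mulr1 Dvar_ord.
  rewrite [LHS]addrC big_ord_recr; congr (_ + _).
    apply: eq_bigr => i _; rewrite peak_insert_nseq ?(ltnW (ltn_ord i)) //=.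
    rewrite addn0 eqSS ltn_eqF // cat_nseq_cons -(subnSK (ltn_ord i)).
    rewrite word_weight_cat // (word_weight_cat 0) // word_weight_cat //.
    by rewrite [word_weight [::]]big_nil mulr1 !mulrA [x 1 * _]mulrC.
  rewrite peak_insert_nseq // addn0 eqxx subnn cat_nseq_cons.
  rewrite (cat_nseq_cons a.+1) word_weight_cat //.
  by rewrite [word_weight [::]]big_nil mulr1.
rewrite def_u => ltn _ lastv.
have vT : ohead v = Some true.
  case: v vF lastv {def_u ltn} => [|[]] // _.
  by rewrite last_cat last_cat /=; elim: b.
have {}lastv : last false v = true.
  case: v vT lastv {def_u ltn vF} => // c v _ /=.
  by rewrite !last_cat /= last_cat.
have vn : (size v < n)%N.
  by move: ltn; rewrite !size_cat !size_nseq; lia.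
have v0 : (0 < size v)%N by case: v vT {IHn def_u ltn lastv vF vn}.
have bvT : ohead (nseq b.+1 false ++ v) != Some true by [].
rewrite word_weight_cat // D_w // word_weight_cat // D_w // IHn // !Dvar_ord.
rewrite !size_cat !size_nseq !big_split_ord /=.
(* This isolates the two gaps next to the peak: the last one of the ascent block and the first one
   of the descent block. *)
rewrite big_ord_recr big_ord_recl /=.
set u' := nseq a.+1 true ++ nseq b.+1 false ++ v.
have E1 (t : 'I_a) : word_weight (peak_insert t u') =
    x 1 * x t.+1 * x (a - t)%N * (x b.+1 * word_weight v).
  have ta := ltn_ord t; rewrite peak_insert_nseq 1?ltnW //.
  have -> : (t.+1 == a.+1 + size (nseq b.+1 false ++ v))%N = false.
    by apply/eqP; rewrite size_cat size_nseq; lia.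
  rewrite cat_nseq_cons word_weight_cat // (word_weight_cat 0).
    by rewrite -(subnSK ta) !word_weight_cat //; ring.
  by rewrite -(subnSK ta).
(* A gap next to the peak lengthens the block on the other side: here the descent block, in [E3] the
   ascent block. *)
have E2 : word_weight (peak_insert a u') =
    x a.+1 * (x b.+2 * word_weight v).
  rewrite peak_insert_nseq // cat_nseq_cons subnn.
  have -> : (a.+1 == a.+1 + size (nseq b.+1 false ++ v))%N = false.
    by apply/eqP; rewrite size_cat size_nseq; lia.
  by rewrite word_weight_cat // (word_weight_cat b.+1).
have E3 : word_weight (peak_insert (a.+1 + 0) u') =
    x a.+2 * (x b.+1 * word_weight v).
  rewrite -{1}(size_nseq a.+1 true) peak_insert_cat.
  rewrite peak_insert_nseq // subn0 [nseq 0 _ ++ _]/= cat_nseq_cons.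
  have -> : (1 == b.+1 + size v)%N = false by apply/eqP; lia.
  by rewrite (word_weight_cat a.+1) // (word_weight_cat b).
(* Every other descent gap puts a single ascent between [t.+1] and [b - t] descents. *)
have E4 (t : 'I_b) : word_weight (peak_insert (a.+1 + t.+1) u') =
    x a.+1 * (x 1 * x t.+1 * x (b - t)%N * word_weight v).
  have tb := ltn_ord t.
  rewrite -{1}(size_nseq a.+1 true) peak_insert_cat.
  rewrite peak_insert_nseq //.
  have -> : (t.+2 == b.+1 + size v)%N = false by apply/eqP; lia.
  rewrite -(subnSK tb) word_weight_cat // word_weight_cat //.
  rewrite (word_weight_cat 0) // (word_weight_cat (b - t.+1)) //; ring.
(* Gaps in [v] leave the first two blocks alone and match the terms of the induction hypothesis. *)
have E5 (t : 'I_(size v)) : word_weight (peak_insert (a.+1 + (b.+1 + t)) u') =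
    x a.+1 * (x b.+1 * word_weight (peak_insert t v)).
  rewrite -{1}(size_nseq a.+1 true) peak_insert_cat.
  rewrite -{1}(size_nseq b.+1 false) peak_insert_cat.
  by rewrite !word_weight_cat ?ohead_peak_insert.
rewrite E2 E3 (eq_bigr _ (fun t _ => E1 t)) (eq_bigr _ (fun t _ => E4 t)).
rewrite (eq_bigr _ (fun t _ => E5 t)) -!mulr_sumr -!mulr_suml.
ring.
Qed.
End WordWeight.

(** * Insertion of the second largest value *)

Section InsertPerm.
Local Open Scope nat_scope.

Definition word n (s : 'S_n.+1) : seq bool :=
  mkseq (fun k => s (inord k) < s (inord k.+1)) n.

Lemma size_word n (s : 'S_n.+1) : size (word s) = n.
Proof. exact: size_mkseq. Qed.

Lemma rising_word_head n (s : 'S_n.+2) :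
  rising_atomic s -> ohead (word s) = Some true.
Proof.
case/andP=> /eqP s0 _ /=.
have -> : inord 0 = ord0 :> 'I_n.+2 by apply: val_inj; rewrite /= inordK.
rewrite s0 /=; have : s (inord 1) != ord0.
  by rewrite -s0 (inj_eq perm_inj) -val_eqE /= inordK.
by rewrite -val_eqE /= -lt0n => ->.
Qed.

Lemma rising_word_last n (s : 'S_n.+2) :
  rising_atomic s -> last false (word s) = true.
Proof.
case/andP=> _ /eqP sn; rewrite -nth_last size_word nth_mkseq //=.
have -> : inord n.+1 = ord_max :> 'I_n.+2 by apply: val_inj; rewrite /= inordK.
rewrite sn /=; have : s (inord n) != ord_max.
  rewrite -[X in _ != X]sn (inj_eq perm_inj) -val_eqE /=.
  by rewrite inordK ?ltn_eqF // ltnW.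
by rewrite -val_eqE /= => sn'; rewrite ltn_neqAle sn' -ltnS ltn_ord.
Qed.

(** [n] is the second largest value for ['S_n.+2], and [lift_perm] renames the old maximum to
    [n.+1]. The new entry thus exceeds all others but the final one. *)
Lemma word_lift_perm n (s : 'S_n.+1) (i : 'I_n.+2) t :
  s ord_max = ord_max -> i = t.+1 :> nat -> t < n ->
  word (lift_perm i (inord n) s) = peak_insert t (word s).
Proof.
move=> sn it tn; set s' := lift_perm _ _ _.
pose v k := val (s (inord k)).
have vn : v n = n.
  rewrite /v (_ : inord n = ord_max) ?sn //.
  by apply: val_inj; rewrite /= inordK.
have v_lt k : k < n -> v k < n.
  move=> kn; rewrite ltn_neqAle -ltnS ltn_ord andbT; apply: contraTneq kn => vk.
  suff /(congr1 val) : inord k = ord_max :> 'I_n.+1.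
    rewrite -leqNgt /=; case: (ltnP k n.+1) => [kn|/ltnW //].
    by rewrite inordK // => ->.
  by apply: (@perm_inj _ s); apply: val_inj; rewrite sn.
(* Left of the new entry the old values are below [n] and stay; on the right [bump n] changes only
   the old maximum. *)
have s'E k : k <= n.+1 -> val (s' (inord k)) =
    if k <= t then v k else if k == t.+1 then n else bump n (v k.-1).
  move=> kn; case: leqP => [kt|tk].
    have -> : inord k = lift i (inord k).
      apply: val_inj; rewrite /= !inordK // ?ltnS ?(leq_trans kt) ?(ltnW tn) //.
      by rewrite /bump it leqNgt ltnS kt.
    rewrite lift_perm_lift /= inordK // /bump leqNgt.
    by rewrite -[nat_of_ord (s _)]/(v k) v_lt // (leq_ltn_trans kt).
  case: eqVneq => [kt|kt].
    have -> : inord k = i by apply: val_inj; rewrite /= inordK // it.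
    by rewrite lift_perm_id /= inordK.
  have -> : inord k = lift i (inord k.-1).
    apply: val_inj; rewrite /= !inordK // ?/bump ?it; lia.
  by rewrite lift_perm_lift /= inordK.
apply: (@eq_from_nth _ false) => [|k].
  by rewrite !size_word size_cat /= size_takel ?size_drop size_word; lia.
rewrite size_word => kn; rewrite nth_mkseq // !s'E ?ltnS //; last exact: ltnW.
rewrite nth_cat size_takel ?size_word; last exact: ltnW.
case: (ltngtP k t) => kt.
- by rewrite nth_take // nth_mkseq // (ltn_trans kt).
- rewrite -subn_gt0 in kt; case E : (k - t) kt => [//|m] _ /=.
  have -> : k = m + t.+1 by lia.
  case: m E => [|m] E /=.
    rewrite add0n eqxx ifF /bump; last by apply/eqP; lia.
    (* If [t.+1 = n], the right neighbour is the renamed maximum, so the second letter is an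
       ascent. *)
    case: (eqVneq t.+1 n) => [->|tn']; first by rewrite vn leqnn add1n ltnSn.
    have /v_lt lt : t.+1 < n by rewrite ltn_neqAle tn' tn.
    by lia.
  rewrite nth_drop nth_mkseq; last lia.
  do 2!(case: ifP => ?; first by lia).
  rewrite !ltnNge leq_bump2 /v addSn [(t.+1 + m)%N]addSn addnS.
  by rewrite [(t + m)%N]addnC.
- by rewrite kt subnn /= eqxx /= v_lt.
Qed.

(** The value [n.+1] is neither least nor greatest, so it cannot stand at an end; at an inner
    position the end entries come from [s]. *)
Lemma rising_lift_perm n (s : 'S_n.+2) (i : 'I_n.+3) :
  rising_atomic (lift_perm i (inord n.+1) s) =
    rising_atomic s && (0 < i < n.+2).
Proof.
rewrite /rising_atomic; set j := inord _.
have jE : val j = n.+1 by rewrite /= inordK.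
case: (unliftP i ord0) => [z zE|<-]; last first.
  by rewrite lift_perm_id -val_eqE /= jE andbF.
case: (unliftP i ord_max) => [m mE|<-]; last first.
  rewrite lift_perm_id -[in X in _ && X = _]val_eqE /= jE ltnn !andbF.
  by rewrite ltn_eqF ?andbF.
have [i0 z0] : 0 < i /\ z = ord0.
  move/(congr1 val): zE; rewrite /= /bump; case: (leqP i z) => //= ? E.
  by split; [lia|apply: val_inj => /=; lia].
have [im m0] : i < n.+2 /\ m = ord_max.
  move/(congr1 val): mE; rewrite /= /bump; have := ltn_ord m.
  case: (leqP i m) => //= ? ? E; last lia.
  by split; [lia|apply: val_inj => /=; lia].
rewrite zE mE !lift_perm_lift z0 m0 i0 im !andbT; congr (_ && _);
  rewrite -!val_eqE /= /bump jE; first lia.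
by have := ltn_ord (s ord_max); lia.
Qed.
End InsertPerm.

(** Insertion is injective between sets of equal cardinality, hence bijective; no inverse has to be
    described. *)
Lemma big_rising_lift_perm (R : nmodType) n (G : 'S_n.+3 -> R) :
  \sum_(s | rising_atomic s) G s =
  \sum_(s : 'S_n.+2 | rising_atomic s) \sum_(t < n.+1)
    G (lift_perm (inord t.+1) (inord n.+1) s).
Proof.
pose h (p : 'S_n.+2 * 'I_n.+3) := lift_perm p.2 (inord n.+1) p.1.
have h_inj : injective h.
  move=> [s i] [s' i'] /permP /= hE.
  have ii : i = i'.
    have := hE i; rewrite /h lift_perm_id; case: (unliftP i' i) => //= k ->.
    by rewrite lift_perm_lift => /eqP; rewrite (negPf (neq_lift _ _)).
  rewrite -ii in hE *; congr (_, _); apply/permP => k.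
  by have := hE (lift i k); rewrite !lift_perm_lift => /lift_inj.
have h_bij : bijective h.
  apply: inj_card_bij h_inj _; rewrite card_prod !card_Sn card_ord.
  by rewrite [(n.+3)`!]factS mulnC.
rewrite (reindex h) /=; last exact: onW_bij.
under eq_bigl do rewrite rising_lift_perm.
rewrite -(pair_big_dep (@rising_atomic n.+1)
  (fun _ (i : 'I_n.+3) => 0 < i < n.+2)%N (fun s i => G (h (s, i)))) /=.
(* The first and last of the [n.+3] positions drop out. *)
apply: eq_bigr => s _; rewrite big_mkcond big_ord_recl /= add0r big_ord_recr /=.
rewrite [X in _ + X]ifF ?addr0 /=; last by rewrite /bump add1n ltnn.
apply: eq_bigr => t _; have tn := ltn_ord t.
rewrite ifT; last by rewrite /bump add1n ltnS.
rewrite /h /=; congr (G (lift_perm _ _ _)); apply: val_inj.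
by rewrite /= inordK /bump; lia.
Qed.

(** * Runs of a permutation as blocks of its ascent word *)

Section Runs.
Local Open Scope nat_scope.

(** The letters are those at [i, ..., j - 1]. In an ascent word they compare neighbours among the
    positions [i, ..., j], so [(i, j)] agrees with the encoding of runs. *)
Definition is_block (w : seq bool) i j : Prop :=
  [/\ i < j <= size w,
      forall k, i <= k < j -> nth false w k = nth false w i,
      0 < i -> nth false w i.-1 != nth false w i
    & j < size w -> nth false w j != nth false w i].

Fixpoint intervals k (ls : seq nat) : seq (nat * nat) :=
  if ls is l :: ls' then (k, k + l) :: intervals (k + l) ls' else [::].

Lemma intervalsK k ls : [seq r.2 - r.1 | r <- intervals k ls] = ls.
Proof. by elim: ls k => //= l ls IHls k; rewrite addKn IHls. Qed.

Lemma intervals_addn k m ls :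
  intervals (k + m) ls = [seq (k + r.1, k + r.2) | r <- intervals m ls].
Proof. by elim: ls m => //= l ls IHls m; rewrite -addnA IHls. Qed.

Lemma intervals_ge k ls r : r \in intervals k ls -> k <= r.1.
Proof.
elim: ls k => //= l ls IHls k; rewrite inE => /orP[/eqP -> //|/IHls].
by apply: leq_trans; apply: leq_addr.
Qed.

Lemma intervals_uniq k ls : all (leq 1) ls -> uniq (intervals k ls).
Proof.
elim: ls k => //= l ls IHls k /andP[l0 /IHls ->]; rewrite andbT.
by apply/negP => /intervals_ge /=; lia.
Qed.

Lemma block_ind (P : seq bool -> Prop) : P [::] ->
  (forall a (b : bool) (w : seq bool),
    ohead w != Some b -> P w -> P (nseq a.+1 b ++ w)) ->
  forall w, P w.
Proof.
move=> P0 IP w; have [n] := ubnP (size w); elim: n => // n IHn in w *.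
case: w => // b w wn; have [[|a] [u [def_w ub]]] := first_block b (b :: w).
  by rewrite /= in def_w; rewrite -def_w eqxx in ub.
rewrite def_w; apply: IP => //; apply: IHn.
by move: wn; rewrite def_w size_cat size_nseq; lia.
Qed.

Lemma blocks_gt0 w : all (leq 1) (blocks w).
Proof. by elim/block_ind: w => // a b w wb IHw; rewrite blocks_cat. Qed.

Lemma sumn_blocks w : sumn (blocks w) = size w.
Proof.
elim/block_ind: w => // a b w wb IHw.
by rewrite blocks_cat //= size_cat size_nseq IHw.
Qed.

(** A block starting among the first [a.+1] letters starts at 0 by left maximality and ends at
    [a.+1], where the letter changes or the word ends. *)
Lemma is_block_cat a (b : bool) (w : seq bool) i j : ohead w != Some b ->
  is_block (nseq a.+1 b ++ w) i j <->
  (i, j) = (0, a.+1) \/ a.+1 <= i /\ is_block w (i - a.+1) (j - a.+1).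
Proof.
move=> wb; set u := _ ++ _.
have su : size u = a.+1 + size w by rewrite size_cat size_nseq.
have u_lt k : k < a.+1 -> nth false u k = b.
  by move=> ka; rewrite nth_cat size_nseq ka nth_nseq ka.
have u_ge k : nth false u (a.+1 + k) = nth false w k.
  by rewrite nth_cat size_nseq ltnNge leq_addr addKn.
have u_eq : 0 < size w -> nth false u a.+1 != b.
  by rewrite -[a.+1]addn0 u_ge; case: (w) wb => [|c w'] //=.
split=> [[/andP[ij ju] const left_max right_max]|].
  have [ia|ai] := ltnP i a.+1; [left|right].
    have i0 : i = 0.
      apply/eqP; rewrite -leqn0 leqNgt; apply/negP => i0.
      by have /negP[] := left_max i0; rewrite !u_lt //; lia.
    congr (_, _) => //; apply/eqP; rewrite eqn_leq; apply/andP; split.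
      rewrite leqNgt; apply/negP => aj.
      have /negP[] : nth false u a.+1 != b by apply: u_eq; lia.
      by rewrite const ?u_lt //; lia.
    rewrite leqNgt; apply/negP => ja.
    have /negP[] : nth false u j != nth false u i by apply: right_max; lia.
    by rewrite !u_lt //; lia.
  split=> //; split; first lia.
  - by move=> k ikj; rewrite -!u_ge subnKC //; apply: const; lia.
  - move=> i0; rewrite -!u_ge subnKC //.
    have -> : a.+1 + (i - a.+1).-1 = i.-1 by lia.
    by apply: left_max; lia.
  by move=> jw; rewrite -!u_ge !subnKC; [apply: right_max| |]; lia.
case=> [[-> ->]|[ai [/andP[ij jw] const left_max right_max]]].
  split=> [|k ka||aw].
  - by rewrite su leq_addr.
  - by rewrite !u_lt.
  - by [].
  by rewrite (u_lt 0) //; apply: u_eq; lia.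
have [i' iE] : exists i', i = a.+1 + i' by exists (i - a.+1); lia.
have [j' jE] : exists j', j = a.+1 + j' by exists (j - a.+1); lia.
rewrite iE jE !addKn in ij jw const left_max right_max *; split; first lia.
- move=> k ikj; have kE : k = a.+1 + (k - a.+1) by lia.
  by rewrite kE !u_ge const //; lia.
(* A block at the start of [w] has no left neighbour there; in [u] that neighbour is [b], which
   differs by [wb]. *)
- move=> _; case: i' {ai iE const right_max} ij left_max => [|i'] ij left_max.
    by rewrite addn0 (u_lt a) // eq_sym u_eq //; lia.
  by rewrite u_ge addnS -pred_Sn u_ge left_max.
by move=> ju; rewrite !u_ge right_max //; lia.
Qed.

Lemma intervals_blocksP w i j :
  reflect (is_block w i j) ((i, j) \in intervals 0 (blocks w)).
Proof.
apply: (iffP idP); elim/block_ind: w i j => [|a b w wb IHw] i j //.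
- rewrite blocks_cat //= inE => /orP[/eqP ij|].
    by apply/is_block_cat; first done; left.
  rewrite -[0 + _]addnC intervals_addn => /mapP[[i' j'] /IHw w_ij [-> ->]].
  by apply/is_block_cat => //; right; rewrite leq_addr !addKn.
- by case=> /andP[+ /= +] _ _ _; case: j.
rewrite blocks_cat // => /is_block_cat [|ij|] //=; last first.
  case=> ai /[dup] [[/andP[? _] _ _ _]] /IHw w_ij.
  rewrite inE -[0 + _]addnC intervals_addn; apply/orP; right.
  by apply/mapP; exists (i - a.+1, j - a.+1) => //=; rewrite !subnKC //; lia.
by rewrite inE ij eqxx.
Qed.

Variables (n : nat) (s : 'S_n.+1).
Let v k := val (s (inord k)).
Let w := word s.

Let nth_w k : k < n -> nth false w k = (v k < v k.+1).
Proof. exact: nth_mkseq. Qed.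

Let vE (a : 'I_n.+1) : v a = s a.
Proof. by rewrite /v inord_val. Qed.

Let v_step k : k < n -> ~~ (v k < v k.+1) -> v k.+1 < v k.
Proof.
move=> kn; rewrite -leqNgt leq_eqVlt => /orP[/eqP|//].
move/val_inj/perm_inj/(congr1 val).
by rewrite /= !inordK //; lia.
Qed.

(** By transitivity it suffices to compare neighbours, and by injectivity a step that is not an
    ascent is a descent. *)
Lemma monotone_onP (i j : 'I_n.+1) : i < j ->
  reflect (forall k, i <= k < j -> nth false w k = nth false w i)
          (monotone_on s i j).
Proof.
move=> ij; have jn := ltn_ord j.
(* [P] will be [ltn] and [gtn]. *)
have step (P : rel nat) :
    (forall a b : 'I_n.+1, [&& i <= a, a < b & b <= j] -> P (s a) (s b)) ->
    forall k, i <= k < j -> P (v k) (v k.+1).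
  by move=> sP k ikj; apply: sP; rewrite !inordK; lia.
have chain (P : rel nat) :
    transitive P -> (forall k, i <= k < j -> P (v k) (v k.+1)) ->
    forall a b : 'I_n.+1, [&& i <= a, a < b & b <= j] -> P (s a) (s b).
  move=> Ptr vP a b /and3P[ia ab bj]; rewrite -!vE.
  have chain_nat d k : i <= k -> k + d < j -> P (v k) (v (k + d).+1).
    elim: d => [|d IHd] ik kj; first by rewrite addn0; apply: vP; lia.
    by rewrite addnS; apply: Ptr (IHd _ _) (vP _ _); lia.
  have -> : nat_of_ord b = (a + (b - a.+1)).+1 by lia.
  by apply: chain_nat; lia.
have w_nth k : i <= k < j -> nth false w k = (v k < v k.+1).
  by move=> ikj; apply: nth_w; lia.
have ii : i <= i < j by lia.
apply: (iffP orP) => [[]|const].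
- move/'forall_'forall_implyP => /(step ltn) up k ikj.
  by rewrite !w_nth //; move/up: ikj => /= ->; move/up: ii => /= ->.
- move/'forall_'forall_implyP => /(step gtn) down k ikj.
  rewrite !w_nth // !ltnNge; move/down: ikj => /= /ltnW ->.
  by move/down: ii => /= /ltnW ->.
case wi : (nth false w i); rewrite wi in const; [left|right];
  apply/'forall_'forall_implyP.
  apply: (chain ltn) => [|k ikj]; first exact: ltn_trans.
  by rewrite /= -w_nth // const.
apply: (chain gtn) => [|k ikj].
  by move=> x y z /= xy yz; apply: ltn_trans yz xy.
by apply: v_step; [lia|rewrite -w_nth // const].
Qed.

(** An equal adjacent letter would extend the run by one position; conversely, a strictly larger
    monotone interval covers an adjacent letter, which is then equal. *)
Lemma is_runP (r : 'I_n.+1 * 'I_n.+1) :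
  reflect (is_block w r.1 r.2) (is_run s r).
Proof.
case: r => i j; have jn := ltn_ord j; rewrite /is_run /=.
apply: (iffP and3P) => [[ij mono /forallP max]|].
  have const := monotone_onP ij mono.
  split.
  - by rewrite ij size_word -ltnS.
  - exact: const.
  - move=> i0; apply/negP => /eqP wi.
    have i'E : val (inord i.-1 : 'I_n.+1) = i.-1 by rewrite /= inordK //; lia.
    have /implyP := max (inord i.-1, j); rewrite /= i'E leq_pred leqnn /=.
    have -> : monotone_on s (inord i.-1) j.
      apply/monotone_onP; rewrite i'E; first lia.
      move=> k ikj; have [ki|ki|->//] := ltngtP k i.-1; first lia.
      by rewrite const ?wi //; lia.
    move=> /(_ isT)/eqP/(congr1 (fun r => val r.1)).
    by rewrite /= in i'E *; lia.
  rewrite size_word => j_lt; apply/negP => /eqP wj.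
  have j'E : val (inord j.+1 : 'I_n.+1) = j.+1 by rewrite /= inordK.
  have /implyP := max (i, inord j.+1); rewrite /= j'E leqnSn leqnn /=.
  have -> : monotone_on s i (inord j.+1).
    apply/monotone_onP; rewrite j'E; first lia.
    move=> k ikj; have [ki|ki|->//] := ltngtP k j; last lia.
    by rewrite const //; lia.
  by move=> /(_ isT)/eqP/(congr1 (fun r => val r.2)); rewrite /= in j'E *; lia.
case=> /= /andP[ij jw] const left_max right_max; split=> //.
  exact/monotone_onP.
apply/forallP => -[i' j'] /=; apply/implyP => /and3P[ii jj].
have j'n := ltn_ord j'.
move/monotone_onP => /(_ ltac:(lia)) const'.
have i_eq : i' = i.
  apply/val_inj/eqP; rewrite /= eqn_leq ii leqNgt; apply/negP => lt_i'i.
  by have /negP[] := left_max ltac:(lia); rewrite !const' //; lia.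
have j_eq : j' = j.
  apply/val_inj/eqP; rewrite /= eqn_leq jj andbT leqNgt; apply/negP => lt_jj'.
  have /negP[] := right_max ltac:(rewrite size_word; lia).
  by rewrite !const' //; lia.
by rewrite i_eq j_eq.
Qed.

(** Runs and block intervals are duplicate-free lists with the same members; only the order of the
    lengths may differ. *)
Lemma perm_run_structure : perm_eq (run_structure s) (blocks w).
Proof.
rewrite /run_structure perm_sort -[blocks w](intervalsK 0).
pose to_nat (r : 'I_n.+1 * 'I_n.+1) := (val r.1, val r.2).
rewrite /image_mem (eq_map (g := (fun r => r.2 - r.1) \o to_nat)) // map_comp.
apply: perm_map; apply: uniq_perm.
- rewrite map_inj_uniq ?enum_uniq // => -[i j] [i' j'].
  by case=> /val_inj-> /val_inj->.
- exact/intervals_uniq/blocks_gt0.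
move=> [i j]; apply/mapP/intervals_blocksP => [[r]|ij].
  by rewrite mem_enum => /is_runP + [-> ->].
have [/andP[ij' jw] _ _ _] := ij; rewrite size_word in jw.
have [iE jE] : val (inord i : 'I_n.+1) = i /\ val (inord j : 'I_n.+1) = j.
  by rewrite /= !inordK //; lia.
exists (inord i, inord j); last by rewrite /to_nat /= iE jE.
by rewrite mem_enum; apply/is_runP; rewrite /= iE jE.
Qed.

Lemma run_structure_intpart : is_intpart n (run_structure s).
Proof.
have rw := perm_run_structure; apply/and3P; split.
- by apply: sort_sorted => x y; apply: leq_total.
- by rewrite (perm_all _ rw) blocks_gt0.
by rewrite (perm_sumn rw) sumn_blocks size_word.
Qed.
End Runs.

(** * Complementation of the values *)

Section Complement.
Variables (n : nat) (s : 'S_n.+1).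

Definition complement : 'S_n.+1 := (s * perm (@rev_ord_inj n.+1))%g.

Lemma complementE i : complement i = rev_ord (s i).
Proof. by rewrite permM permE. Qed.

Lemma complement_ltn i j : (complement i < complement j)%N = (s j < s i)%N.
Proof.
by rewrite !complementE /=; have := ltn_ord (s i); have := ltn_ord (s j); lia.
Qed.

(** Increase and decrease are exchanged, and both count as monotone. *)
Lemma complement_monotone i j : monotone_on complement i j = monotone_on s i j.
Proof.
rewrite /monotone_on orbC; congr (_ || _);
  by apply: eq_forallb => a; apply: eq_forallb => b; rewrite complement_ltn.
Qed.

Lemma complement_is_run : is_run complement =1 is_run s.
Proof.
move=> r; rewrite /is_run complement_monotone; congr [&& _, _ & _].
by apply: eq_forallb => r'; rewrite complement_monotone.
Qed.

Lemma complement_run_structure : run_structure complement = run_structure s.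
Proof.
rewrite /run_structure; congr sort; apply: eq_image => // r.
exact: complement_is_run.
Qed.

Lemma complement_falling : falling_atomic complement = rising_atomic s.
Proof.
rewrite /falling_atomic /rising_atomic !complementE -!val_eqE /=.
by have := ltn_ord (s ord0); have := ltn_ord (s ord_max); lia.
Qed.

End Complement.

Lemma Z_rising_falling n (p : intpart n) : Z_rising p = Z_falling p.
Proof.
have complement_inj : injective (@complement n) by move=> s t /mulIg.
rewrite /Z_rising /Z_falling -[RHS](card_preimset _ complement_inj).
apply: eq_card => s; rewrite !inE complement_falling.
by rewrite complement_run_structure.
Qed.

(** * The generating polynomial and its recurrence *)

Lemma prod_count_mem (R : comNzRingType) (x : nat -> R) N (p : seq nat) :
  all (fun l => 0 < l < N)%N p ->
  \prod_(l <- p) x l = \prod_(1 <= i < N) x i ^+ count_mem i p.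
Proof.
elim: p => [_|l p IHp /= /andP[lN /IHp IH]].
  by rewrite big_nil big1.
rewrite big_cons IH; under [RHS]eq_bigr do rewrite exprD.
rewrite big_split /=; congr (_ * _).
rewrite (bigD1_seq l) ?mem_index_iota ?iota_uniq //= eqxx expr1 big1 ?mulr1 //.
by move=> i /negPf il; rewrite eq_sym il expr0.
Qed.

Lemma intpart_bounds n (p : intpart n) : all (fun l => 0 < l < n.+1)%N p.
Proof.
have /and3P[_ /allP p_gt0 /eqP sp] := partsP p.
apply/allP => l lp; rewrite p_gt0 //= ltnS -sp sumnE (big_rem l) //=.
exact: leq_addr.
Qed.

(** The weight depends only on the multiset of block lengths, so it is constant on the permutations
    with a given run structure. *)
Lemma sum_rising_word_weight (R : comNzRingType) (x : nat -> R) n :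
  \sum_(s : 'S_n.+1 | rising_atomic s) word_weight x (word s) =
  \sum_(p : intpart n)
    (Z_rising p)%:R * \prod_(1 <= i < n.+1) x i ^+ count_mem i p.
Proof.
pose f (s : 'S_n.+1) := IntPart (run_structure_intpart s).
rewrite (partition_big f xpredT) //=; apply: eq_bigr => p _.
rewrite -prod_count_mem ?intpart_bounds // mulr_natl -sumr_const.
apply: eq_big => [s|s /andP[_ /eqP <-]]; first by rewrite inE.
by rewrite /word_weight -(perm_big _ (perm_run_structure s)).
Qed.

(** Brings products of variables into the form required by [D_xvarM]. *)
Lemma prod_xvar (ls : seq nat) :
  exists m : {cmonom nat}, \prod_(l <- ls) xvar l = << m >>.
Proof.
elim: ls => [|l ls [m IH]]; first by exists mone; rewrite big_nil.
by exists (mmul (ucm l.-1) m); rewrite big_cons IH; apply: xvarMU.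
Qed.

Lemma D1 : D 1 = 0.
Proof.
have d1 i : pderiv i << mone >> = 0 by rewrite pderivU cm1 monalgU0.
(* All derivatives of 1 vanish, so the sums may be cut at 0. *)
have -> := @D_trunc 0 1 (fun i _ => d1 i).
exact: Dtrunc0.
Qed.

Lemma D_cons l ls : (0 < l)%N ->
  D (xvar l * \prod_(k <- ls) xvar k) =
    Dvar xvar l * \prod_(k <- ls) xvar k + xvar l * D (\prod_(k <- ls) xvar k).
Proof. by move=> l0; have [m ->] := prod_xvar ls; apply: D_xvarM. Qed.

Lemma rising_atomic2 (s : 'S_2) : rising_atomic s = (s == 1%g).
Proof.
apply/andP/eqP => [[/eqP s0 /eqP s1]|->]; last by rewrite !perm1.
apply/permP => i; rewrite perm1.
case: (unliftP ord0 i) => [j ->|->] //; rewrite (ord1 j).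
by have -> : lift ord0 0 = ord_max :> 'I_2 by apply: val_inj.
Qed.

Lemma A_rising n :
  A n.+1 = \sum_(s : 'S_n.+2 | rising_atomic s) word_weight xvar (word s).
Proof.
elim: n => [|n IHn].
  rewrite (eq_bigl _ _ rising_atomic2) big_pred1_eq.
  have : ohead (word (1%g : 'S_2)) = Some true.
    by apply: rising_word_head; rewrite rising_atomic2.
  (* The word is a single ascent, of weight [xvar 1]. *)
  have := size_word (1%g : 'S_2); case: (word _) => [|b []] // _ [->].
  by rewrite /word_weight /= big_seq1.
(* One application of [D] matches one insertion, for each shorter permutation separately. *)
rewrite -[LHS]/(D (A n.+1)) IHn D_sum big_rising_lift_perm.
apply: eq_bigr => s s_rising; rewrite (D_word_weight D1 D_cons).
- rewrite size_word; apply: eq_bigr => t _.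
  rewrite (@word_lift_perm _ _ _ t) //; first by case/andP: s_rising => _ /eqP.
  by rewrite inordK // ltnS ltnW // ltnS.
- exact: rising_word_head.
exact: rising_word_last.
Qed.

Theorem proposition3 (n : nat) (hn : (1 <= n)%N) :
  (forall p : intpart n, Z_rising p = Z_falling p) /\
  A n = \sum_(p : intpart n)
          (Z_rising p)%:R * \prod_(1 <= i < n.+1) xvar i ^+ count_mem i p.
Proof.
split; first exact: Z_rising_falling.
by case: n hn => // n _; rewrite A_rising sum_rising_word_weight.
Qed.
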